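(* Let an arbitrary collection of complex numbers $$\{\lambda_k,\ \beta_{kj}\ (j=1,\dots,m_k,\ k=1,\dots,p)\}$$ be given, where $\lambda_1,\lambda_2,\dots,\lambda_p$ ($1\le p\le N$) are distinct, $1\le m_k\le N$, and $m_1+\dots+m_p=N$. In order for this collection to be the spectral data for some $N\times N$ Jacobi matrix $J$ with entries $a_n,b_n\in\mathbb{C}$, $a_n\ne0$, it is necessary and sufficient that the following two conditions be satisfied: (i) $\sum_{k=1}^{p}\beta_{k1}=1$; (ii) $D_n\ne0$ for $n\in\{1,2,\dots,N-1\}$, and $D_N=0$, where $D_n=\det(s_{i+j})_{i,j=0}^{n}$ with $$s_l=\sum_{k=1}^{p}\sum_{j=1}^{n_{kl}}\binom{l}{j-1}\beta_{kj}\lambda_k^{\,l-j+1},\qquad l=0,1,\dots,2N,\qquad n_{kl}=\min\{m_k,l+1\},$$ $\binom{l}{j-1}$ being a binomial coefficient.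
   Context: $N$ is a positive integer. A (complex) Jacobi matrix $J$ here is an $N\times N$ symmetric tridiagonal matrix (rows and columns indexed $0,\dots,N-1$) with diagonal entries $b_0,\dots,b_{N-1}\in\mathbb{C}$, with nonzero entries $a_n\in\mathbb{C}$ in positions $(n,n+1)$ and $(n+1,n)$ for $0\le n\le N-2$, and zeros elsewhere. Put $a_{N-1}=1$. The polynomials $P_0(\lambda),\dots,P_N(\lambda)$ associated with $J$ are defined by $P_0(\lambda)=1$, $b_0P_0(\lambda)+a_0P_1(\lambda)=\lambda P_0(\lambda)$, $a_{n-1}P_{n-1}(\lambda)+b_nP_n(\lambda)+a_nP_{n+1}(\lambda)=\lambda P_n(\lambda)$ for $n\in\{1,\dots,N-1\}$. $\mathbb{C}_m[\lambda]$ is the space of polynomials of degree $\le m$ with complex coefficients. The generalized spectral function of $J$ is the unique linear functional $\Omega:\mathbb{C}_{2N}[\lambda]\to\mathbb{C}$ such that $\langle\Omega,P_mP_n\rangle=\delta_{mn}$ for $m,n\in\{0,\dots,N-1\}$ and $\langle\Omega,P_mP_N\rangle=0$ for $m\in\{0,\dots,N\}$. Spectral data of $J$: let $\lambda_1,\dots,\lambda_p$ be all the distinct eigenvalues of $J$ and $m_1,\dots,m_p$ their multiplicities as roots of $\det(J-\lambda I)$. There are uniquely determined complex numbers $\beta_{kj}$ ($j=1,\dots,m_k$, $k=1,\dots,p$) such that $\langle\Omega,G\rangle=\sum_{k=1}^{p}\sum_{j=1}^{m_k}\frac{\beta_{kj}}{(j-1)!}G^{(j-1)}(\lambda_k)$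 for all $G\in\mathbb{C}_{2N}[\lambda]$. The collection $\{\lambda_k,\beta_{kj}\ (j=1,\dots,m_k,\ k=1,\dots,p)\}$ is called the spectral data of $J$. The convention $0^0=1$ is used. *)

(* Defs.v *)
From HB Require Import structures.
From mathcomp Require Import all_boot all_order all_algebra.
From mathcomp Require Import zify ring.

Set Implicit Arguments.
Unset Strict Implicit.
Unset Printing Implicit Defensive.

Import GRing.Theory.
Local Open Scope ring_scope.

(* The N x N Jacobi matrix with diagonal b_0, ..., b_{N-1} and off-diagonal
   a_0, ..., a_{N-2}; values of the sequences a and b at other indices are
   irrelevant throughout. *)
Definition jacobi_mx (F : fieldType) (N : nat) (a b : nat -> F) : 'M[F]_N :=
  \matrix_(i < N, j < N)
    if i == j :> nat then b i
    else if j == i.+1 :> nat then a i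
    else if i == j.+1 :> nat then a j
    else 0.

Definition offdiag_nonzero (F : fieldType) (N : nat) (a : nat -> F) : Prop :=
  forall n : nat, (n.+1 < N)%N -> a n != 0.

(* The sequence a with the convention a_{N-1} = 1. *)
Definition acoef (F : fieldType) (N : nat) (a : nat -> F) (n : nat) : F :=
  if n == N.-1 then 1 else a n.

(* The three-term recurrence, solved for its leading term; jacobi_poly0,
   jacobi_poly1 and jacobi_polySS restate it in its usual form. *)
Fixpoint jacobi_poly (F : fieldType) (N : nat) (a b : nat -> F) (n : nat)
    : {poly F} :=
  match n with
  | 0 => 1
  | n1.+1 =>
      (acoef N a n1)^-1 *:
        (('X - (b n1)%:P) * jacobi_poly N a b n1
         - (if n1 is n2.+1 then acoef N a n2 *: jacobi_poly N a b n2 else 0))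
  end.

(* A linear functional on the polynomials of degree <= 2N, i.e. of
   size <= 2N+1; on the products below, whose degrees are at most 2N, the
   truncation performed by npolyp is the identity (npolypK). *)
Definition generalized_spectral_function (F : fieldType) (N : nat)
    (a b : nat -> F) (Omega : {scalar {poly_((2 * N).+1) F}}) : Prop :=
  let P := jacobi_poly N a b in
  (forall m n : nat, (m < N)%N -> (n < N)%N ->
     Omega (npolyp (2 * N).+1 (P m * P n)) = (m == n)%:R)
  /\ (forall m : nat, (m <= N)%N ->
        Omega (npolyp (2 * N).+1 (P m * P N)) = 0).

(* beta k j is meaningful for 1 <= j <= m k only. *)
Definition spectral_data (F : fieldType) (N : nat) (a b : nat -> F)
    (p : nat) (lambda : 'I_p -> F) (m : 'I_p -> nat)
    (beta : 'I_p -> nat -> F) : Prop :=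
  let J := jacobi_mx N a b in
  [/\ injective lambda,
      forall x : F, eigenvalue J x <-> exists k : 'I_p, x = lambda k,
      forall k : 'I_p, m k = mup (lambda k) (char_poly J)
    & exists2 Omega : {scalar {poly_((2 * N).+1) F}},
        generalized_spectral_function a b Omega
      & forall G : {poly_((2 * N).+1) F},
          Omega G = \sum_(k < p) \sum_(1 <= j < (m k).+1)
                      beta k j / ((j.-1)`!)%:R * (G^`(j.-1)).[lambda k]].

(* The exponent l - j + 1 is a natural number, as j <= l + 1. *)
Definition moment (F : fieldType) (p : nat) (lambda : 'I_p -> F)
    (m : 'I_p -> nat) (beta : 'I_p -> nat -> F) (l : nat) : F :=
  \sum_(k < p) \sum_(1 <= j < (minn (m k) l.+1).+1)
     'C(l, j.-1)%:R * beta k j * lambda k ^+ (l.+1 - j).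

Definition hankel_det (F : fieldType) (s : nat -> F) (n : nat) : F :=
  \det (\matrix_(i < n.+1, j < n.+1) s (i + j)%N).

Section JacobiPolyTheory.
Context (F : fieldType) (N : nat) (a b : nat -> F).

Let A := acoef N a.
Let P := jacobi_poly N a b.

Lemma acoef_neq0 n : offdiag_nonzero N a -> (n < N)%N -> A n != 0.
Proof.
move=> a_neq0 ltnN; rewrite /A /acoef.
case: (n =P N.-1) => [_|nN]; first exact: oner_neq0.
apply: a_neq0; rewrite ltn_neqAle ltnN andbT; apply/eqP => nE.
by apply: nN; rewrite -nE.
Qed.

Lemma jacobi_poly0 : P 0%N = 1.
Proof. by []. Qed.

Lemma jacobi_poly1 : offdiag_nonzero N a -> (0 < N)%N ->
  b 0%N *: P 0%N + A 0%N *: P 1%N = 'X * P 0%N.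
Proof.
move=> a_neq0 N_gt0.
rewrite /P /= scalerA mulfV ?acoef_neq0 // scale1r subr0.
by rewrite !mulr1 alg_polyC addrC subrK.
Qed.

Lemma jacobi_polySS n : offdiag_nonzero N a -> (n.+1 < N)%N ->
  A n *: P n + b n.+1 *: P n.+1 + A n.+1 *: P n.+2 = 'X * P n.+1.
Proof.
move=> a_neq0 ltnN.
have -> : A n.+1 *: P n.+2 = ('X - (b n.+1)%:P) * P n.+1 - A n *: P n.
  by rewrite [P n.+2]/= scalerA mulfV ?acoef_neq0 // scale1r.
by rewrite -!mul_polyC; ring.
Qed.

Lemma size_jacobi_poly n : offdiag_nonzero N a -> (n <= N)%N ->
  size (P n) = n.+1.
Proof.
move=> a_neq0; elim/ltn_ind: n => -[|n] IHn ltnN; first by rewrite size_poly1.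
rewrite /P /= size_scale ?invr_eq0 ?acoef_neq0 // -/P.
have sP : size (('X - (b n)%:P) * P n) = n.+2.
  have sPn := IHn n (ltnSn n) (ltnW ltnN).
  by rewrite size_mul ?polyXsubC_eq0 -?size_poly_gt0 ?size_XsubC ?sPn.
rewrite size_polyDl // size_polyN sP.
case: n IHn ltnN {sP} => [|n] IHn ltnN; first by rewrite size_poly0.
apply: leq_ltn_trans (size_scale_leq _ _) _.
by rewrite -/(P n) IHn //; apply: ltnW; apply: ltnW.
Qed.

Lemma generalized_spectral_function_unique
    (Omega1 Omega2 : {scalar {poly_((2 * N).+1) F}}) :
  offdiag_nonzero N a ->
  generalized_spectral_function a b Omega1 ->
  generalized_spectral_function a b Omega2 ->
  Omega1 =1 Omega2.
Proof.
move=> a_neq0 [on1 oN1] [on2 oN2].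
have OmE m n : (m <= n)%N -> (n <= N)%N -> Omega1 (npolyp _ (P m * P n))
                                        = Omega2 (npolyp _ (P m * P n)).
  move=> lemn; rewrite leq_eqVlt => /predU1P[nE|ltnN].
    by rewrite nE in lemn *; rewrite oN1 ?oN2.
  by rewrite on1 ?on2 // (leq_ltn_trans lemn).
suff eqd d (G : {poly_((2 * N).+1) F}) : (size G <= d)%N ->
    (d <= (2 * N).+1)%N -> Omega1 G = Omega2 G.
  by move=> G; apply: (eqd (2 * N).+1); rewrite ?size_npoly.
elim: d G => [|d IHd] G.
  rewrite leqn0 size_poly_eq0 => /eqP G0 _.
  by have -> : G = 0 by [apply: val_inj]; rewrite !linear0.
move=> sG led; have led2 : (d <= 2 * N)%N by [].
pose i := d./2; pose j := (d - i)%N.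
have [leij lejN] : (i <= j)%N /\ (j <= N)%N by rewrite /j /i; lia.
have leiN := leq_trans leij lejN.
have ijd : (i + j = d)%N by rewrite /j /i; lia.
have Pn0 k : (k <= N)%N -> P k != 0.
  by move=> leN; rewrite -size_poly_gt0 size_jacobi_poly.
have sQ : size (P i * P j) = d.+1.
  by rewrite size_mul ?Pn0 // !size_jacobi_poly // addSn addnS ijd.
have QE : npolyp (2 * N).+1 (P i * P j) = P i * P j :> {poly F}.
  by apply: npolypK; rewrite sQ.
pose c := G`_d / lead_coef (P i * P j).
have -> : G = (G - c *: npolyp _ (P i * P j)) + c *: npolyp _ (P i * P j).
  by rewrite subrK.
rewrite linearD [RHS]linearD; congr (_ + _); last by rewrite !linearZ /= OmE.
apply: IHd (ltnW led) => /=.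
apply/leq_sizeP => k; rewrite leq_eqVlt => /predU1P[<-|ltdk]; rewrite coefB coefZ QE.
  by rewrite /c lead_coefE sQ divfK ?subrr // -[d]/(d.+1.-1) -sQ -lead_coefE
             lead_coef_eq0 -size_poly_gt0 sQ.
by rewrite !nth_default ?mulr0 ?subrr ?sQ // (leq_trans sG).
Qed.

End JacobiPolyTheory.

(* The functional is G |-> (G(J))_{00}. *)
Lemma generalized_spectral_function_exists (F : fieldType) (N : nat)
    (a b : nat -> F) :
  (0 < N)%N -> offdiag_nonzero N a ->
  exists Omega : {scalar {poly_((2 * N).+1) F}},
    generalized_spectral_function a b Omega.
Proof.
case: N => // N _ a_neq0.
pose J := jacobi_mx N.+1 a b; pose P := jacobi_poly N.+1 a b.
pose e n : 'rV[F]_N.+1 := \row_j (j == n :> nat)%:R.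
have eM n k (M : 'M[F]_(N.+1, k)) (i : 'I_N.+1) : i = n :> nat -> e n *m M = row i M.
  move=> <-; rewrite rowE; congr (_ *m _); apply/rowP => j.
  by rewrite !mxE eqxx.
have JT : J^T = J.
  apply/matrixP => i j; rewrite !mxE eq_sym.
  case: eqVneq => [->//|ij]; case: eqP => [->|_]; case: eqP => //; lia.
have hJT (p : {poly F}) : (horner_mx J p)^T = horner_mx J p.
  elim/poly_ind: p => [|p c IHp]; first by rewrite rmorph0 trmx0.
  rewrite rmorphD rmorphM /= horner_mx_X horner_mx_C linearD /= tr_scalar_mx.
  rewrite trmx_mul IHp JT; congr (_ + _).
  by apply: comm_mx_horner; exact: erefl.
have eP n : (n <= N.+1)%N -> e 0%N *m horner_mx J (P n) = e n.
  elim/ltn_ind: n => -[|n] IHn ltnN.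
    by rewrite rmorph1 mulmx1.
  rewrite /P /= linearZ /= rmorphB /= [_ * jacobi_poly _ _ _ _]mulrC rmorphM /=.
  rewrite -scalemxAr mulmxBr mulmxA -/(P n) (IHn n) //; last exact: ltnW.
  rewrite rmorphB /= horner_mx_X horner_mx_C mulmxBr mul_mx_scalar.
  have -> : e 0%N *m horner_mx J
     (if n is n2.+1 then acoef N.+1 a n2 *: P n2 else 0)
     = if n is n2.+1 then acoef N.+1 a n2 *: e n2 else 0.
    case: n IHn ltnN => [|n] IHn ltnN; first by rewrite rmorph0 mulmx0.
    by rewrite linearZ /= -scalemxAr IHn //; exact: ltnW (ltnW ltnN).
  rewrite (eM n _ J (Ordinal ltnN)) //; apply/rowP => j.
  rewrite [LHS]mxE; apply: (canLR (mulKf (acoef_neq0 a_neq0 ltnN))).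
  have acE k : (k < N)%N -> acoef N.+1 a k = a k.
    by move=> kN; rewrite /acoef /= ltn_eqF.
  have TE : (if n is n2.+1 then acoef N.+1 a n2 *: e n2 else 0) 0 j
            = if n == j.+1 :> nat then a j else 0.
    case: n ltnN {IHn} => [|n] ltnN; first by rewrite mxE.
    rewrite !mxE eqSS eq_sym; case: eqP => [<-|_]; last by rewrite mulr0.
    by rewrite mulr1 acE.
  rewrite !mxE TE /= [n == j :> nat]eq_sym.
  have jN := ltn_ord j; case: (eqVneq (j : nat) n.+1) => [jE|_].
    have [-> -> ->] : [/\ (j == n :> nat) = false, (n == j.+1) = false
                       & acoef N.+1 a n = a n].
      by split; [lia | lia | apply: acE; lia].
    by rewrite mulr0 mulr1 !subr0.
  rewrite mulr0; case: (eqVneq (j : nat) n) => [->|_].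
    by rewrite ltn_eqF // mulr1 subrr subr0.
  by rewrite mulr0 subr0 subrr.
have Om_scalar : GRing.linear_for *%R
    (fun G : {poly_((2 * N.+1).+1) F} => horner_mx J (polyn G) ord0 ord0).
  by move=> c G H; rewrite /= linearP !mxE.
pose Om := HB.pack_for {scalar {poly_((2 * N.+1).+1) F}}
  (fun G : {poly_((2 * N.+1).+1) F} => horner_mx J (polyn G) ord0 ord0)
  (GRing.isLinear.Build _ _ _ _ _ Om_scalar).
have OmE m n : (m <= N.+1)%N -> (n <= N.+1)%N ->
    Om (npolyp _ (P m * P n)) = (e m *m (e n)^T) 0 0.
  move=> lem len; rewrite /Om /= npolypK; last first.
    apply: leq_trans (size_polyMleq _ _) _.
    by rewrite !size_jacobi_poly //; lia.
  have e0 : e 0%N = delta_mx 0 0 by apply/rowP => j; rewrite !mxE.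
  rewrite -(eP m) // -(eP n) // trmx_mul hJT e0 trmx_delta.
  rewrite -mulmxA [horner_mx J (P m) *m _]mulmxA -colE -rowE.
  by rewrite [RHS]mxE [RHS]mxE rmorphM.

have eN0 m : (m <= N.+1)%N -> (e m *m (e N.+1)^T) 0 0 = 0.
  move=> _; rewrite mxE big1 // => j _; rewrite !mxE.
  by rewrite (ltn_eqF (ltn_ord j)) mulr0.
exists Om; split=> [m n ltm ltn|m lem]; last first.
  by rewrite [LHS](OmE _ _ lem (leqnn _)) eN0.
rewrite [LHS](OmE _ _ (ltnW ltm) (ltnW ltn)) (eM m _ _ (Ordinal ltm)) //.
by rewrite !mxE.
Qed.

(* Main.v *)
(* Let W be the functional G |-> sum_k sum_j beta_kj / (j-1)! G^(j-1)(lambda_k)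
   on all polynomials: its moments are the s_l, and it kills every multiple of
   T = prod_k (X - lambda_k)^(m_k), of degree N; hence D_N = 0.
   A kernel vector of the Hankel matrix of order n is a polynomial Q of degree
   at most n with W(Q R) = 0 for all R of degree at most n, and there is no
   nonzero such Q when W has an orthonormal basis P_0, ..., P_n.
   Conversely, if D_n <> 0 for n < N, the Lanczos (Gram-Schmidt) recursion,
   with square roots taken in the complex numbers, yields a, b whose P_n are
   orthonormal for n < N, and P_N is orthogonal to all of them. By
   nondegeneracy P_N is proportional to T. As e_0 P_n(J) = e_n for n < N and
   e_0 P_N(J) = 0, Cayley-Hamilton makes P_N proportional to the
   characteristic polynomial of J too, which is therefore T. *)
From HB Require Import structures.
Require Import Defs.
From mathcomp Require Import all_boot all_order all_algebra.
From mathcomp Require Import complex.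
From mathcomp Require Import reals.
From mathcomp Require Import zify ring.

Set Implicit Arguments.
Unset Strict Implicit.
Unset Printing Implicit Defensive.

Import GRing.Theory Num.Theory.
Local Open Scope ring_scope.

(** * Expansions in a polynomial basis and Hankel determinants *)

Lemma poly_basis_expand (F : fieldType) (P : nat -> {poly F}) (n : nat) :
  (forall i, (i < n)%N -> size (P i) = i.+1) ->
  forall Q : {poly F}, (size Q <= n)%N ->
  exists c : nat -> F, Q = \sum_(i < n) c i *: P i.
Proof.
elim: n => [|n IHn] sP Q sQ.
  exists (fun=> 0); rewrite big_ord0; apply/eqP.
  by rewrite -size_poly_eq0 -leqn0.
have sPn := sP n (ltnSn n).
have Pn_neq0 : (P n)`_n != 0.
  by rewrite -[n in _`_n]/(n.+1.-1) -sPn -lead_coefE lead_coef_eq0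
             -size_poly_gt0 sPn.
pose d := Q`_n / (P n)`_n.
have sR : (size (Q - d *: P n)%R <= n)%N.
  apply/leq_sizeP => j; rewrite leq_eqVlt coefB coefZ => /predU1P[<-|ltnj].
    by rewrite divfK ?subrr.
  by rewrite !nth_default ?mulr0 ?subrr ?sPn // (leq_trans sQ).
have [i ltin|c cE] := IHn _ _ sR; first by apply: sP; apply: ltnW.
exists (fun i => if i == n then d else c i).
rewrite big_ord_recr /= eqxx; apply: (canRL (subrK _)); rewrite cE.
by apply: eq_bigr => i _; rewrite ltn_eqF.
Qed.

Lemma size_sub_lead_monic (R : nzRingType) (Q S : {poly R}) (n : nat) :
  size Q = n.+1 -> size S = n.+1 -> S \is monic ->
  (size (Q - lead_coef Q *: S)%R <= n)%N.
Proof.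
move=> sQ sS /monicP; rewrite [lead_coef Q]lead_coefE lead_coefE sQ sS /= => Sn.
apply/leq_sizeP => j; rewrite leq_eqVlt coefB coefZ => /predU1P[<-|ltnj].
  by rewrite Sn mulr1 subrr.
by rewrite [Q`_j]nth_default ?[S`_j]nth_default ?mulr0 ?subrr ?sQ ?sS.
Qed.

(** A row vector v in the left kernel is read as the coefficients of Q: entry j of v times the
    matrix is W(Q X^j), and the X^j with j <= n span the admissible R. *)
Lemma hankel_det_eq0P (F : fieldType) (W : {scalar {poly F}}) (s : nat -> F)
    (n : nat) :
  (forall l, s l = W 'X^l) ->
  reflect (exists Q : {poly F}, [/\ Q != 0, (size Q <= n.+1)%N &
             forall R : {poly F}, (size R <= n.+1)%N -> W (Q * R) = 0])
          (hankel_det s n == 0).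
Proof.
move=> sE.
have HE (v : 'rV[F]_n.+1) (j : 'I_n.+1) :
    (v *m (\matrix_(i < n.+1, j < n.+1) s (i + j)%N)) 0 j
    = W (rVpoly v * 'X^j).
  rewrite mxE -[X in W (X * _)]coefK poly_def mulr_suml linear_sum.
  rewrite (big_ord_widen_cond n.+1 predT
            (fun i => W (((rVpoly v)`_i *: 'X^i) * 'X^j))) ?size_poly //=.
  rewrite [RHS]big_mkcond; apply: eq_bigr => i _; rewrite mxE sE -coef_rVpoly_ord.
  case: ifP => [_|]; first by rewrite -scalerAl linearZ exprD.
  by move/negbT; rewrite -leqNgt => szi; rewrite nth_default ?mul0r.
apply: (iffP det0P) => [[v v_neq0 vH]|[Q [Q_neq0 sQ QH]]].
  exists (rVpoly v); split; first 1 last.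
  - exact: size_poly.
  - move=> R sR; rewrite -[R]coefK poly_def mulr_sumr linear_sum big1 // => j _.
    rewrite -scalerAr linearZ /=.
    by rewrite -(HE v (widen_ord sR j)) vH mxE mulr0.
  by apply: contra_neq v_neq0 => v0; rewrite -[v]rVpolyK v0 linear0.
exists (poly_rV Q).
  by apply: contra_neq Q_neq0 => Q0; rewrite -(poly_rV_K sQ) Q0 linear0.
apply/rowP => j; rewrite HE poly_rV_K // QH ?mxE // size_polyXn.
exact: ltn_ord.
Qed.

Definition orthonormal_upto (F : fieldType) (W : {scalar {poly F}})
    (P : nat -> {poly F}) (n : nat) : Prop :=
  forall i j, (i < n)%N -> (j < n)%N -> W (P i * P j) = (i == j)%:R.

Lemma orthonormal_coef (F : fieldType) (W : {scalar {poly F}})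
    (P : nat -> {poly F}) (n : nat) (c : nat -> F) (j : 'I_n) :
  orthonormal_upto W P n -> W ((\sum_(i < n) c i *: P i) * P j) = c j.
Proof.
move=> orthP; rewrite mulr_suml linear_sum (bigD1 j) //= big1 => [|i neq_ij].
  by rewrite addr0 -scalerAl linearZ /= orthP // eqxx mulr1.
by rewrite -scalerAl linearZ /= orthP // (val_eqE i j) (negPf neq_ij) mulr0.
Qed.

Lemma orthonormal_eq0 (F : fieldType) (W : {scalar {poly F}})
    (P : nat -> {poly F}) (n : nat) (Q : {poly F}) :
  orthonormal_upto W P n -> (forall i, (i < n)%N -> size (P i) = i.+1) ->
  (size Q <= n)%N -> (forall i, (i < n)%N -> W (Q * P i) = 0) -> Q = 0.
Proof.
move=> orthP sP sQ WQ; have [c cE] := poly_basis_expand sP sQ.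
rewrite cE big1 // => i _.
by rewrite -(orthonormal_coef c i orthP) -cE WQ ?scale0r.
Qed.

Lemma orthonormal_hankel_det (F : fieldType) (W : {scalar {poly F}})
    (s : nat -> F) (P : nat -> {poly F}) (n : nat) :
  (forall l, s l = W 'X^l) -> (forall i, (i <= n)%N -> size (P i) = i.+1) ->
  orthonormal_upto W P n.+1 -> hankel_det s n != 0.
Proof.
move=> sE sP orthP; apply/negP => /(hankel_det_eq0P _ sE)[Q [Q_neq0 sQ WQ]].
case/eqP: Q_neq0; apply: (orthonormal_eq0 orthP) => // i lein.
by apply: WQ; rewrite sP.
Qed.

Arguments jacobi_poly : simpl never.

(** * Three-term recurrence and orthogonality *)

Section JacobiPoly.
Context (F : fieldType) (N : nat) (a b : nat -> F).
Hypothesis a_neq0 : offdiag_nonzero N a.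

Let A := acoef N a.
Let P := jacobi_poly N a b.

(** With the value 0 at [n = 0], the recurrence takes one form for all n. *)
Definition jacobi_tail n : {poly F} := if n is n1.+1 then A n1 *: P n1 else 0.

Lemma jacobi_polyS n :
  P n.+1 = (A n)^-1 *: (('X - (b n)%:P) * P n - jacobi_tail n).
Proof. by []. Qed.

Lemma mulX_jacobi_poly n : (n < N)%N ->
  'X * P n = jacobi_tail n + b n *: P n + A n *: P n.+1.
Proof.
move=> ltnN; rewrite jacobi_polyS scalerA mulfV ?acoef_neq0 // scale1r.
by rewrite -!mul_polyC; ring.
Qed.

Lemma jacobi_tail_orth (W : {scalar {poly F}}) n i j :
  orthonormal_upto W P n -> (i <= n)%N -> (j < n)%N ->
  W (jacobi_tail i * P j) = if i == j.+1 then A j else 0.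
Proof.
move=> orthP; case: i => [|i] lein ltjn; first by rewrite mul0r linear0.
rewrite -scalerAl linearZ /= orthP // eqSS; case: eqP => [->|_].
  by rewrite mulr1.
by rewrite mulr0.
Qed.

(** Pair the recurrence for [P n] with [P i]. For [i = n] the choice of [b n] cancels W(X P_n P_n).
    For [i < n] the factor X moves to [P i], whose expansion meets [P n] only through
    [A i *: P i.+1]; this counts only when [i.+1 = n], where the tail subtracts the same [A i]. *)
Lemma jacobi_poly_orth_step (W : {scalar {poly F}}) n i :
  (n < N)%N -> orthonormal_upto W P n.+1 -> b n = W ('X * P n * P n) ->
  (i <= n)%N -> W (P n.+1 * P i) = 0.
Proof.
move=> ltnN orthP bE lein.
apply: (mulfI (acoef_neq0 a_neq0 ltnN)); rewrite mulr0.
have -> : A n * W (P n.+1 * P i) =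
    W ('X * P n * P i) - b n * W (P n * P i) - W (jacobi_tail n * P i).
  rewrite mulX_jacobi_poly // !mulrDl !linearD /= -!scalerAl !linearZ /=.
  by ring.
rewrite orthP // (jacobi_tail_orth orthP) ?ltnS // 1?ltnW //.
case: (ltngtP i n) lein => // [ltin _|-> _]; last first.
  by rewrite mulr1 -bE subrr eqn_leq ltnn andbF subr0.
rewrite mulr0 subr0.
have -> : 'X * P n * P i = ('X * P i) * P n by ring.
rewrite mulX_jacobi_poly ?(ltn_trans ltin) // !mulrDl !linearD /= -2!scalerAl.
rewrite 2!linearZ /= !orthP ?ltnS // 1?ltnW // (jacobi_tail_orth orthP) //; last lia.
rewrite (ltn_eqF ltin) mulr0 addr0 [n == i.+1]eq_sym.
have -> : (i == n.+1) = false by lia.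
by rewrite add0r mulr_natr mulrb subrr.
Qed.

End JacobiPoly.

(** * Construction of the Jacobi coefficients from W *)

Section Lanczos.
Context (C : numClosedFieldType) (W : {scalar {poly C}}).

Definition lanczos_diag (P : {poly C}) : C := W ('X * P * P).

Definition lanczos_residue (P T : {poly C}) : {poly C} :=
  ('X - (lanczos_diag P)%:P) * P - T.

(* The fallback value 1 makes all a_n nonzero, so that the degrees of the P_n
   are known before W is shown to be nondegenerate. *)
Definition lanczos_offdiag (P T : {poly C}) : C :=
  let q := lanczos_residue P T in
  if W (q * q) == 0 then 1 else sqrtC (W (q * q)).

(* The pair (P_n, a_{n-1} P_{n-1}). *)
Fixpoint lanczos (n : nat) : {poly C} * {poly C} :=
  if n is n1.+1 then
    let: (P, T) := lanczos n1 in
    let a := lanczos_offdiag P T in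
    (a^-1 *: lanczos_residue P T, a *: P)
  else (1, 0).

Definition lanczos_a n := lanczos_offdiag (lanczos n).1 (lanczos n).2.
Definition lanczos_b n := lanczos_diag (lanczos n).1.

Lemma lanczos_a_neq0 n : lanczos_a n != 0.
Proof.
rewrite /lanczos_a /lanczos_offdiag; case: ifPn => [_|]; first exact: oner_neq0.
by rewrite sqrtC_eq0.
Qed.

(** [lanczos] reads the coefficients off the polynomials, [jacobi_poly] does the reverse. They agree
    below N, where the convention a_{N-1} = 1 has not yet entered. *)
Lemma lanczos_jacobi_poly N n : (n < N)%N ->
  lanczos n = (jacobi_poly N lanczos_a lanczos_b n,
               jacobi_tail N lanczos_a lanczos_b n).
Proof.
elim: n => // n IHn ltnN.
have an : acoef N lanczos_a n = lanczos_a n.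
  by rewrite /acoef; case: eqP => // nN; move: ltnN; rewrite nN; lia.
rewrite jacobi_polyS /= an {1}/lanczos_a {1}/lanczos_b IHn 1?ltnW //=.
by congr (_, _); rewrite /lanczos_a IHn 1?ltnW.
Qed.

Lemma lanczos_orthonormal N s :
  (forall l, s l = W 'X^l) -> W 1 = 1 ->
  (forall n, (1 <= n <= N.-1)%N -> hankel_det s n != 0) ->
  let P := jacobi_poly N lanczos_a lanczos_b in
  orthonormal_upto W P N /\ forall i, (i < N)%N -> W (P N * P i) = 0.
Proof.
move=> sE W1 Hs P.
have a_neq0 : offdiag_nonzero N lanczos_a by move=> n _; exact: lanczos_a_neq0.
have sP n : (n <= N)%N -> size (P n) = n.+1 by exact: size_jacobi_poly.
have bE n : (n < N)%N -> lanczos_b n = W ('X * P n * P n).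
  by move=> ltnN; rewrite /lanczos_b (lanczos_jacobi_poly ltnN).
have orthP n : (n <= N)%N -> orthonormal_upto W P n.
  elim: n => [|n IHn] ltnN; first by [].
  case: n IHn ltnN => [_ _|n /(_ (ltnW _)) IHn ltnN].
    by move=> [|//] [|//] _ _; rewrite mulr1.
  have {}IHn : orthonormal_upto W P n.+1 by apply: IHn.
  have step i : (i < n.+1)%N -> W (P n.+1 * P i) = 0.
    by move=> ltin; apply: (jacobi_poly_orth_step a_neq0 _ IHn) => //;
       rewrite ?bE // ltnW.
  have aE : acoef N lanczos_a n = lanczos_a n.
    by rewrite /acoef; case: eqP => // nN; move: ltnN; rewrite nN; lia.
  pose q := lanczos_residue (P n) (jacobi_tail N lanczos_a lanczos_b n).
  have anE : lanczos_a n
      = if W (q * q) == 0 then 1 else sqrtC (W (q * q)).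
    by rewrite /lanczos_a (lanczos_jacobi_poly (ltnW ltnN)).
  have PE : P n.+1 = (lanczos_a n)^-1 *: q.
    rewrite /P jacobi_polyS aE; congr (_ *: (_ - _)).
    by rewrite bE // ltnW.
  have WPP : W (P n.+1 * P n.+1) = (lanczos_a n)^-1 ^+ 2 * W (q * q).
    rewrite PE -scalerAl linearZ /= -scalerAr linearZ /=.
    by rewrite mulrA expr2.
  have Wqq : W (q * q) != 0.
    (* Otherwise P_{n+1} is orthogonal to itself as well as to the earlier P_i, hence a kernel
       polynomial for D_{n+1}. *)
    apply/eqP => Wqq0.
    have : hankel_det s n.+1 != 0 by apply: Hs; lia.
    case/negP.
    apply/(hankel_det_eq0P _ sE); exists (P n.+1); split.
    - by rewrite -size_poly_gt0 sP // ltnW.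
    - by rewrite sP // ltnW.
    move=> R sR.
    have [|c ->] := @poly_basis_expand _ P n.+2 _ R sR.
      by move=> i ltin; apply: sP; lia.
    rewrite mulr_sumr linear_sum big1 // => i _; rewrite -scalerAr linearZ /=.
    have := ltn_ord i; rewrite ltnS leq_eqVlt => /predU1P[->|/step->].
      by rewrite WPP Wqq0 !mulr0.
    by rewrite mulr0.
  have norm1 : W (P n.+1 * P n.+1) = 1.
    rewrite WPP anE (negPf Wqq) exprVn sqrtCK.
    by rewrite mulVf.
  move=> i j; rewrite ltnS leq_eqVlt => /predU1P[->|ltin];
    rewrite ltnS leq_eqVlt => /predU1P[->|ltjn].
  - by rewrite norm1 eqxx.
  - by rewrite step // gtn_eqF.
  - by rewrite mulrC step // ltn_eqF.
  - exact: IHn.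
split=> [|i ltiN]; first exact: orthP.
(* [P N] is scaled by a_{N-1} = 1 instead of [lanczos_a N.-1]; orthogonality to the earlier P_i does
   not depend on this scale. *)
case: N ltiN {Hs} @P a_neq0 sP bE orthP => // n ltin P a_neq0 sP bE orthP.
by apply: (jacobi_poly_orth_step a_neq0 _ (orthP n.+1 (leqnn _))) => //; exact: bE.
Qed.

End Lanczos.

(** * The last polynomial and the characteristic polynomial *)

Section CharPoly.
Context (F : fieldType) (N' : nat) (a b : nat -> F).
Hypothesis a_neq0 : offdiag_nonzero N'.+1 a.
Local Notation N := N'.+1.
Local Notation J := (jacobi_mx N a b).
Local Notation P := (jacobi_poly N a b).
Local Notation A := (acoef N a).

(** At [n = N] this is 0, which makes the row formula below hold for the last row too. *)
Let e n : 'rV[F]_N := \row_j (j == n :> nat)%:R.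

Let e_mul_jacobi_mx n : (n < N)%N ->
  e n *m J = (if n is n1.+1 then A n1 *: e n1 else 0) + b n *: e n + A n *: e n.+1.
Proof.
move=> ltnN.
have -> : e n *m J = row (Ordinal ltnN) J.
  by rewrite rowE; congr (_ *m _); apply/rowP => j; rewrite !mxE.
have AE k : (k < N')%N -> A k = a k by move=> ltk; rewrite /acoef ltn_eqF.
have TE (j : 'I_N) : (if n is n1.+1 then A n1 *: e n1 else 0) 0 j
                     = if n == j.+1 then a j else 0.
  case: n ltnN => [|n] ltnN; first by rewrite mxE.
  rewrite !mxE eqSS [n == j]eq_sym; case: eqP => [->|_]; last by rewrite mulr0.
  by rewrite mulr1 AE.
apply/rowP => j; rewrite [RHS]mxE [X in X + _]mxE TE !mxE /= [n == j]eq_sym.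
have ltjN := ltn_ord j.
case: (ltngtP j n) => [ltjn|ltnj|->].
- have -> : (j == n.+1 :> nat) = false by lia.
  by rewrite !mulr0 !addr0.
- have -> : (n == j.+1 :> nat) = false by lia.
  by rewrite mulr0 !add0r mulr_natr mulrb; case: eqP => // jn; rewrite AE //; lia.
have -> : (n == n.+1) = false by lia.
by rewrite mulr1 mulr0 add0r addr0.
Qed.

(** Both sides obey the same recurrence, one by [mulX_jacobi_poly], the other by the rows of J;
    cancelling the nonzero [A n] gives the next term. *)
Let row0_horner_jacobi_poly n : (n <= N)%N -> e 0 *m horner_mx J (P n) = e n.
Proof.
elim/ltn_ind: n => -[|n] IHn ltnN; first by rewrite rmorph1 mulmx1.
apply: (scalerI (acoef_neq0 a_neq0 ltnN)).
move: (P n.+1) (mulX_jacobi_poly b a_neq0 ltnN) => Q.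
move/(congr1 (fun R => e 0 *m horner_mx J R)).
rewrite [in LHS]mulrC rmorphM /= horner_mx_X mulmxA IHn // 1?ltnW //.
rewrite e_mul_jacobi_mx // !rmorphD /= !mulmxDr !linearZ /=.
rewrite IHn // 1?ltnW //.
have -> : e 0 *m horner_mx J (jacobi_tail N a b n)
          = if n is n1.+1 then A n1 *: e n1 else 0.
  case: n IHn ltnN => [|n] IHn ltnN; first by rewrite rmorph0 mulmx0.
  by rewrite linearZ /= -scalemxAr IHn //; lia.
by move/addrI=> ->.
Qed.

(** The difference of the two sides has degree below N, so it is a combination of [P 0], ...,
    [P N.-1]. At J, applied to [e 0], it becomes the same combination of the independent rows [e i]
    and vanishes, so its coefficients are 0. *)
Lemma jacobi_poly_char_poly : P N = lead_coef (P N) *: char_poly J.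
Proof.
have sP n : (n <= N)%N -> size (P n) = n.+1 by exact: size_jacobi_poly.
set c := lead_coef _; apply/eqP; rewrite -subr_eq0; apply/eqP.
have sD : (size (P N - c *: char_poly J)%R <= N)%N.
  by apply: size_sub_lead_monic; rewrite ?sP ?size_char_poly ?char_poly_monic.
have [|d dE] := @poly_basis_expand _ P N _ _ sD.
  by move=> i ltiN; rewrite sP // ltnW.
have : e 0 *m horner_mx J (P N - c *: char_poly J) = 0.
  rewrite rmorphB /= [horner_mx J (c *: _)]linearZ /= Cayley_Hamilton scaler0.
  rewrite subr0 row0_horner_jacobi_poly //.
  by apply/rowP => j; rewrite !mxE (ltn_eqF (ltn_ord j)).
rewrite dE => e0.
rewrite big1 // => j _; move/rowP/(_ j): e0.
rewrite rmorph_sum mulmx_sumr summxE (bigD1 j) //= big1 ?addr0.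
  rewrite linearZ /= -scalemxAr row0_horner_jacobi_poly; last exact: ltnW.
  by rewrite !mxE eqxx mulr1 => ->; rewrite scale0r.
move=> i neq_ij; rewrite linearZ /= -scalemxAr row0_horner_jacobi_poly; last exact: ltnW.
by rewrite !mxE (val_eqE j i) eq_sym (negPf neq_ij) mulr0.
Qed.

End CharPoly.

(** * The functional W given by the data, and the polynomial T *)

Lemma root_derivn_mul_XsubC_exp (R : comNzRingType) (x : R) (n i : nat)
    (Q : {poly R}) :
  (i < n)%N -> ((('X - x%:P) ^+ n * Q)^`(i)).[x] = 0.
Proof.
elim: i n Q => [|i IHi] [|n] Q // ltin.
  by rewrite derivn0 exprS -mulrA hornerM hornerXsubC subrr mul0r.
rewrite derivSn.
have -> : (('X - x%:P) ^+ n.+1 * Q)^`()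
    = ('X - x%:P) ^+ n * (n.+1%:R * Q + ('X - x%:P) * Q^`()).
  rewrite derivM deriv_exp derivXsubC mul1r /= exprSr -mulr_natr; ring.
exact: IHi.
Qed.

Section ConfluentFunctional.
Context (F : numFieldType) (p : nat) (lambda : 'I_p -> F) (m : 'I_p -> nat).
Context (beta : 'I_p -> nat -> F).

(** The derivative of order j - 1 comes already divided by (j - 1)!, so its value on X^l yields the
    binomial coefficient of the moments. *)
Definition confluent_functional (G : {poly F}) : F :=
  \sum_(k < p) \sum_(1 <= j < (m k).+1) beta k j * (G^`N(j.-1)).[lambda k].

Lemma confluent_functional_is_scalar : GRing.linear_for *%R confluent_functional.
Proof.
move=> c G H; rewrite /confluent_functional mulr_sumr -big_split /=.
apply: eq_bigr => k _; rewrite mulr_sumr -big_split /=; apply: eq_bigr => j _.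
by rewrite nderivnD nderivnZ hornerD hornerZ; ring.
Qed.

HB.instance Definition _ :=
  GRing.isLinear.Build F {poly F} F *%R confluent_functional
    confluent_functional_is_scalar.

Lemma confluent_functionalE (G : {poly F}) :
  confluent_functional G =
  \sum_(k < p) \sum_(1 <= j < (m k).+1)
     beta k j / ((j.-1)`!)%:R * (G^`(j.-1)).[lambda k].
Proof.
apply: eq_bigr => k _; apply: eq_bigr => j _.
rewrite nderivn_def hornerMn -[_.[_] *+ _]mulr_natr mulrA -mulrAC divfK //.
by rewrite pnatr_eq0 -lt0n fact_gt0.
Qed.

Lemma moment_confluent_functional l :
  moment lambda m beta l = confluent_functional 'X^l.
Proof.
apply: eq_bigr => k _.
rewrite [RHS](big_cat_nat (n := (minn (m k) l.+1).+1)) //=; last by lia.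
(* For j > l + 1 the binomial coefficient vanishes, whence the cut-off at min(m_k, l + 1). *)
rewrite [X in _ + X]big_nat_cond [X in _ + X]big1 ?addr0; last first.
  move=> j /andP[/andP[lej ltj] _]; rewrite nderivnXn bin_small ?mulr0n ?horner0 ?mulr0 //.
  lia.
apply: eq_big_nat => j /andP[gt0j lej]; rewrite nderivnXn hornerMn hornerXn.
rewrite -[_ ^+ _ *+ _]mulr_natr; have -> : (l - j.-1 = l.+1 - j)%N by lia.
by ring.
Qed.

Lemma confluent_functional1 : (forall k, (1 <= m k)%N) ->
  confluent_functional 1 = \sum_(k < p) beta k 1%N.
Proof.
move=> m_gt0; apply: eq_bigr => k _; rewrite big_ltn ?ltnS //=.
rewrite big_nat_cond big1 ?addr0; last first.
  move=> [//|[//|j]] _ /=; rewrite -polyC1 nderivnC /= horner0 mulr0 //.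
by rewrite nderivn0 hornerC mulr1.
Qed.

Definition root_poly : {poly F} := \prod_(k < p) ('X - (lambda k)%:P) ^+ m k.

Lemma root_poly_monic : root_poly \is monic.
Proof. by apply: monic_prod => k _; apply: monic_exp; apply: monicXsubC. Qed.

Lemma size_root_poly : size root_poly = (\sum_(k < p) m k).+1.
Proof.
rewrite size_prod; last by move=> k _; rewrite expf_neq0 ?polyXsubC_eq0.
have -> : (\sum_(k < p) size (('X - (lambda k)%:P) ^+ m k)
           = \sum_(k < p) m k + \sum_(k < p) 1)%N.
  by rewrite -big_split /=; apply: eq_bigr => k _; rewrite size_exp_XsubC addn1.
by rewrite sum1_card; lia.
Qed.

(** At lambda_k only derivatives of order below m_k occur, and the factor (X - lambda_k)^(m_k) makes
    them vanish. *)
Lemma confluent_functional_root_poly G : confluent_functional (root_poly * G) = 0.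
Proof.
rewrite confluent_functionalE big1 // => k _; rewrite big_nat_cond big1 // => j.
rewrite andbT => /andP[gt0j lej].
rewrite /root_poly (bigD1 k) //= -[_ * _ * G]mulrA root_derivn_mul_XsubC_exp ?mulr0 //; lia.
Qed.

Lemma mup_root_poly k : injective lambda -> mup (lambda k) root_poly = m k.
Proof.
move=> inj; rewrite /root_poly (bigD1 k) //= mupMl ?mup_XsubCX ?eqxx //.
rewrite /root horner_prod; apply/prodf_neq0 => i neq_ik.
by rewrite horner_exp hornerXsubC expf_neq0 // subr_eq0 eq_sym (inj_eq inj).
Qed.

Lemma root_root_poly x : (forall k, (0 < m k)%N) ->
  root root_poly x <-> exists k, x = lambda k.
Proof.
move=> m_gt0; rewrite /root horner_prod; split=> [/prodf_eq0[k _]|[k ->]].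
  by rewrite horner_exp hornerXsubC expf_eq0 subr_eq0 => /andP[_ /eqP]; exists k.
by apply/prodf_eq0; exists k; rewrite // horner_exp hornerXsubC subrr expr0n gtn_eqF.
Qed.

End ConfluentFunctional.

(** * Restriction of a functional to bounded degree *)

Section Npoly.
Context (F : fieldType) (W : {scalar {poly F}}) (d : nat).

Definition npoly_functional (G : {poly_d F}) : F := W (polyn G).

Lemma npoly_functional_is_scalar : GRing.linear_for *%R npoly_functional.
Proof. by move=> c G H; rewrite /npoly_functional linearP. Qed.

HB.instance Definition _ :=
  GRing.isLinear.Build F {poly_d F} F *%R npoly_functional
    npoly_functional_is_scalar.

End Npoly.

(** * Necessity and sufficiency of the conditions *)

Section SpectralData.
Context (C : numClosedFieldType) (N : nat) (p : nat).
Context (lambda : 'I_p -> C) (m : 'I_p -> nat) (beta : 'I_p -> nat -> C).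
Hypothesis N_gt0 : (0 < N)%N.
Hypothesis lambda_inj : injective lambda.
Hypothesis m_gt0 : forall k, (0 < m k)%N.
Hypothesis sum_m : (\sum_(k < p) m k)%N = N.

Let W : {scalar {poly C}} := confluent_functional lambda m beta.
Let s := moment lambda m beta.
Let T := root_poly lambda m.

Let sE l : s l = W 'X^l. Proof. exact: moment_confluent_functional. Qed.

Let hankel_det_size : hankel_det s N = 0.
Proof.
apply/eqP/(hankel_det_eq0P _ sE); exists T; split.
- by rewrite monic_neq0 ?root_poly_monic.
- by rewrite size_root_poly sum_m.
by move=> R _; apply: confluent_functional_root_poly.
Qed.

Lemma spectral_data_necessary a b :
  offdiag_nonzero N a -> spectral_data N a b lambda m beta ->
  \sum_(k < p) beta k 1%N = 1
  /\ (forall n, (1 <= n <= N.-1)%N -> hankel_det s n != 0)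
     /\ hankel_det s N = 0.
Proof.
move=> a_neq0 [_ _ _ [Omega [orthO _] OmE]].
pose P := jacobi_poly N a b.
have sP n : (n <= N)%N -> size (P n) = n.+1 by exact: size_jacobi_poly.
(* The spectral data formula says that Omega is W in degrees at most 2N, so orthonormality passes to
   W. *)
have orthP : orthonormal_upto W P N.
  move=> i j ltiN ltjN; rewrite -(orthO i j) // OmE -confluent_functionalE.
  rewrite npolypK //; apply: leq_trans (size_polyMleq _ _) _.
  by rewrite !sP 1?ltnW //; lia.
split; [|split] => // [|n /andP[_ lenN]].
  (* As P_0 = 1, the sum of the beta_k1 is W(P_0 P_0). *)
  by rewrite -(confluent_functional1 lambda beta m_gt0) -[1]mulr1 (orthP 0 0).
apply: (orthonormal_hankel_det (P := P) sE) => [i lein|i j ltin ltjn].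
  by apply: sP; lia.
by apply: orthP; lia.
Qed.

Lemma spectral_data_sufficient :
  \sum_(k < p) beta k 1%N = 1 ->
  (forall n, (1 <= n <= N.-1)%N -> hankel_det s n != 0) ->
  exists a b, offdiag_nonzero N a /\ spectral_data N a b lambda m beta.
Proof.
move=> sum_beta Hs; pose a := lanczos_a W; pose b := lanczos_b W.
pose P := jacobi_poly N a b.
have a_neq0 : offdiag_nonzero N a by move=> n _; exact: lanczos_a_neq0.
have sP n : (n <= N)%N -> size (P n) = n.+1 by exact: size_jacobi_poly.
have [] := lanczos_orthonormal sE _ Hs.
  by rewrite -sum_beta; apply: confluent_functional1.
rewrite -/a -/b -/P => orthP orthN.
have lP_neq0 : lead_coef (P N) != 0 by rewrite lead_coef_eq0 -size_poly_gt0 sP.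
have sT : size T = N.+1 by rewrite size_root_poly sum_m.
(* The difference has degree below N and is orthogonal to every P_i with i < N, since both [P N] and
   T are. *)
have PNE : P N = lead_coef (P N) *: T.
  apply/eqP; rewrite -subr_eq0; apply/eqP; apply: (orthonormal_eq0 orthP).
  - by move=> i ltiN; apply: sP; apply: ltnW.
  - by apply: size_sub_lead_monic; rewrite ?sP ?root_poly_monic.
  move=> i ltiN; rewrite mulrBl -scalerAl linearB linearZ /= orthN //.
  by rewrite confluent_functional_root_poly mulr0 subr0.
have charE : char_poly (jacobi_mx N a b) = T.
  apply: (scalerI lP_neq0); rewrite -PNE.
  case: N N_gt0 @P a_neq0 {lP_neq0 PNE orthP orthN sP sT Hs} => // n _ P a_neq0.
  by rewrite -jacobi_poly_char_poly.
exists a, b; split=> //; split=> //.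
- by move=> x; rewrite eigenvalue_root_char charE; apply: root_root_poly.
- by move=> k; rewrite charE mup_root_poly.
exists (npoly_functional W (d := (2 * N).+1)); last first.
  by move=> G; apply: confluent_functionalE.
have OmE i j : (i <= N)%N -> (j <= N)%N ->
    npoly_functional W (npolyp (2 * N).+1 (P i * P j)) = W (P i * P j).
  move=> leiN lejN; rewrite /npoly_functional npolypK //.
  apply: leq_trans (size_polyMleq _ _) _.
  by rewrite !sP //; lia.
split=> [i j ltiN ltjN|i leiN]; first by rewrite [LHS]OmE ?orthP // ltnW.
(* W kills every multiple of T; this covers P_N P_N as well. *)
rewrite [LHS]OmE // mulrC PNE -scalerAl linearZ /=.
by rewrite confluent_functional_root_poly mulr0.
Qed.

End SpectralData.

Theorem theorem6 (R : realType) (N : nat) (hN : (0 < N)%N)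
    (p : nat) (hp : (1 <= p <= N)%N)
    (lambda : 'I_p -> R[i]) (hlambda : injective lambda)
    (m : 'I_p -> nat) (hm : forall k : 'I_p, (1 <= m k <= N)%N)
    (hsum : (\sum_(k < p) m k)%N = N)
    (beta : 'I_p -> nat -> R[i]) :
  let s := moment lambda m beta in
  (exists a b : nat -> R[i],
     offdiag_nonzero N a /\ spectral_data N a b lambda m beta)
  <->
  (\sum_(k < p) beta k 1%N = 1
   /\ ((forall n : nat, (1 <= n <= N.-1)%N -> hankel_det s n != 0)
       /\ hankel_det s N = 0)).
Proof.
have m_gt0 k : (0 < m k)%N by case/andP: (hm k).
move=> s; split=> [[a [b [a_neq0 spec]]]|[sum_beta [Hs _]]].
  exact: spectral_data_necessary spec.
exact: spectral_data_sufficient.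
Qed.
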